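(* For all $1\le j\le d$, $$\kappa_{d,j}=\frac{d!}{j!}\sum_{l=0}^{j}(-1)^{j-l}\binom{j}{l}\binom{lr}{d}.$$
   Context: Let $r\ge1$ be an integer. The constants $\kappa_{d,j}$ ($1\le j\le d$), depending only on $d,j,r$, are the coefficients in the formula $\partial_x^d[\eta(x^r)]=\sum_{j=1}^d\kappa_{d,j}\,x^{jr-d}\,\eta^{(j)}(x^r)$, valid for every holomorphic function $\eta$ of one variable (with $\kappa_{d,j}=0$ when $jr<d$). Equivalently they are given by the recursion $\kappa_{1,1}=r$, $\kappa_{d+1,j}=(jr-d)\,\kappa_{d,j}+r\,\kappa_{d,j-1}$ for $1\le j\le d+1$, with the convention $\kappa_{d,0}=\kappa_{d,d+1}=0$. *)

(* Defs.v *)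
From mathcomp Require Export all_boot all_order all_algebra.
From mathcomp Require Export complex.
From mathcomp Require Export all_classical all_reals all_analysis.
Export Order.TTheory GRing.Theory Num.Theory.
Export numFieldNormedType.Exports.

Set Implicit Arguments.
Unset Strict Implicit.
Unset Printing Implicit Defensive.

Local Open Scope classical_set_scope.
Local Open Scope ring_scope.

(* R[i] is not directly equipped with a topology by the libraries; naming it as
   a numClosedFieldType gives it the norm topology of its modulus and makes
   derivatives on it complex derivatives. *)
Definition Cplx (R : realType) : numClosedFieldType := complex R.

Definition holomorphic_on (R : realType) (U : set (Cplx R))
    (eta : Cplx R -> Cplx R) :=
  open U /\ forall z, U z -> derivable eta z 1.

(* The coefficients kappa d j, 1 <= j <= d, of the d-th derivative of
   x |-> eta (x ^ r), uniform in the holomorphic function eta. The exponent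
   j * r - d is an integer, possibly negative; the terms with j * r < d have a
   zero coefficient, so the value of 0 ^ n for n < 0 plays no role. *)
Definition chain_coefs (R : realType) (r : nat)
    (kappa : nat -> nat -> Cplx R) :=
  (forall d j : nat, (1 <= j <= d)%N -> (j * r < d)%N -> kappa d j = 0) /\
  (forall d : nat, (1 <= d)%N ->
   forall (U : set (Cplx R)) (eta : Cplx R -> Cplx R), holomorphic_on U eta ->
   forall x : Cplx R, U (x ^+ r) ->
     derive1n d (fun z => eta (z ^+ r)) x =
     \sum_(1 <= j < d.+1)
        kappa d j * x ^ ((j * r)%:Z - d%:Z) * derive1n j eta (x ^+ r)).

(* Main.v *)
Require Import Defs.

Local Open Scope ring_scope.

(** Evaluate the defining identity of the coefficients at [x = 1] for
    [eta z = (z - 1) ^+ j]. Every derivative of [eta] at [1] vanishes except the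
    [j]-th one, which is [j`!], so the right-hand side reduces to
    [kappa d j * j`!]; the left-hand side is obtained by differentiating the
    binomial expansion of [(z ^+ r - 1) ^+ j] termwise. *)

(* [is_derive_poly] in MathComp-Analysis is restricted to real fields. *)
Lemma is_derive_horner (K : numFieldType) (p : {poly K}) (x : K) :
  is_derive x 1 (horner p : K -> K) p^`().[x].
Proof.
elim/poly_ind: p => [|p c IHp].
  rewrite (_ : horner 0 = cst 0); last by apply/funext => y; rewrite horner0.
  by rewrite deriv0 horner0; exact: is_derive_cst.
rewrite (_ : horner _ = (horner p : K -> K) * id + cst c); last first.
  by apply/funext => y; rewrite hornerMXaddC.
apply: is_derive_eq.
by rewrite derivMXaddC !hornerE /= [X in X + _]mulr1 [X in _ + X]mulrC.
Qed.

Lemma derive1n_horner (K : numFieldType) (p : {poly K}) (n : nat) :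
  derive1n n (horner p : K -> K) = horner p^`(n).
Proof.
elim: n => [|n IHn]; first by rewrite derive1n0 derivn0.
rewrite derive1nS IHn derivnS; apply/funext => x.
by rewrite derive1E; case: (is_derive_horner _ p^`(n) x).
Qed.

Lemma derivn_XsubC_exp (A : comNzRingType) (c : A) (m n : nat) :
  (('X - c%:P) ^+ m)^`(n) = ('X - c%:P) ^+ (m - n) *+ m ^_ n.
Proof.
elim: n => [|n IHn]; first by rewrite derivn0 subn0 ffactn0.
rewrite derivnS IHn derivMn deriv_exp derivXsubC mul1r -mulrnA.
by rewrite ffactnSr mulnC subnS.
Qed.

(** For [n < m] a positive power of ['X - c%:P] remains and vanishes at [c]; for [n > m] the falling
    factorial is zero. *)
Lemma horner_derivn_XsubC_exp (A : comNzRingType) (c : A) (m n : nat) :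
  (('X - c%:P) ^+ m)^`(n).[c] = (m`! * (m == n))%:R.
Proof.
rewrite derivn_XsubC_exp hornerMn horner_exp hornerXsubC subrr expr0n subn_eq0.
have [lt_mn|lt_nm|->] := ltngtP m n.
- by rewrite ffact_small // mulr0n muln0.
- by rewrite mul0rn muln0.
- by rewrite ffactnn muln1.
Qed.

(** At 1 the [d]-th derivative of ['X^(l * r)] is the falling factorial [(l * r) ^_ d], which is d!
    times ['C(l * r, d)]; both are zero when [l * r < d]. *)
Lemma horner_derivn_Xn_sub1_exp (A : comNzRingType) (r j d : nat) :
  (('X^r - 1 : {poly A}) ^+ j)^`(d).[1] =
  d`!%:R * \sum_(0 <= l < j.+1) (-1) ^+ (j - l) * 'C(j, l)%:R * 'C(l * r, d)%:R.
Proof.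
rewrite [_ ^+ j](_ : _ = \sum_(l < j.+1) ((-1) ^+ (j - l) * 'C(j, l)%:R) *: 'X^(l * r)).
  rewrite big_mkord linear_sum horner_sum mulr_sumr; apply: eq_bigr => l _.
  rewrite /= derivnZ hornerZ derivnXn hornerMn hornerXn expr1n -bin_ffact natrM.
  by rewrite [_%:R * d`!%:R]mulrC mulrCA.
(* [exprDn] gives the exponent [j - l] to the first summand, so -1 is moved to the front. *)
rewrite addrC exprDn; apply: eq_bigr => l _.
rewrite -exprM mulnC -scaler_nat -[-1]/(- 1%:P) -polyCN -polyC_exp mul_polyC.
by rewrite scalerA mulrC.
Qed.

Theorem proposition8p1 (R : realType) (r : nat) (hr : (1 <= r)%N)
    (kappa : nat -> nat -> Cplx R) (hkappa : chain_coefs r kappa)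
    (d j : nat) (hjd : (1 <= j <= d)%N) :
  kappa d j =
  (d`!)%:R / (j`!)%:R *
  \sum_(0 <= l < j.+1) (-1) ^+ (j - l) * ('C(j, l))%:R * ('C(l * r, d))%:R.
Proof.
case/andP: hjd => j_gt0 le_jd; case: hkappa => _ hkappa.
pose p : {poly Cplx R} := ('X - 1%:P) ^+ j.
have holp : holomorphic_on [set: Cplx R]%classic (horner p).
  by split=> [|z _]; [exact: openT | have [] := is_derive_horner _ p z].
have := hkappa d (leq_trans j_gt0 le_jd) _ _ holp 1 I.
rewrite (_ : (fun z => p.[z ^+ r]) = horner (('X^r - 1) ^+ j)); last first.
  by apply/funext => z; rewrite /p !hornerE.
rewrite derive1n_horner expr1n.
rewrite (bigD1_seq j) ?iota_uniq ?mem_index_iota ?j_gt0 //=.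
rewrite [X in _ = _ + X]big1 => [|i /negPf ij]; last first.
  by rewrite derive1n_horner horner_derivn_XsubC_exp eq_sym ij muln0 mulr0.
(* The integer power of [x = 1] is 1 even when [j * r - d] is negative. *)
rewrite addr0 derive1n_horner horner_derivn_XsubC_exp eqxx muln1 exp1rz mulr1.
rewrite horner_derivn_Xn_sub1_exp => eq_kappa.
by rewrite mulrAC eq_kappa mulfK // pnatr_eq0 -lt0n fact_gt0.
Qed.
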